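(* Let $A=\{a_{ij}: i\ne j,\ i,j\ge1\}$ with $a_{ij}\prec a_{kl}$ iff $j=k$. For $f:[n]\to[n]$, a word $w=w_1\cdots w_n$ over $A$ is $f$-compatible if $w_{f(j)}\prec w_j$ for every $j\in[n]$ with $f(j)\neq j$; let $\mathbf S^f(A)$ be the sum of all $f$-compatible words. Then: (i) the $\mathbf S^f$, $f$ ranging over all endofunctions of all $[n]$, $n\ge0$, are linearly independent; (ii) $\mathbf S^f\mathbf S^g=\mathbf S^{f\bullet g}$, so their span $\mathbf{EFSym}$ is a subalgebra of $\mathbb K\langle\langle A\rangle\rangle$; (iii) letting letters of $A$ commute with those of $B$, $$\mathbf S^f(A\oplus B)=\sum_{I\models f}\mathbf S^{\mathrm{std}(f^{[n]\setminus I})}(A)\,\mathbf S^{\mathrm{std}(f^I)}(B);$$ (iv) with the coproduct $\Delta\mathbf S^f=\sum_{I\models f}\mathbf S^{\mathrm{std}(f^{[n]\setminus I})}\otimes\mathbf S^{\mathrm{std}(f^I)}$ (i.e. $\Delta F=F(A\oplus B)$), $\mathbf{EFSym}$ is a graded (non-cocommutative) Hopf algebra.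
   Context: For $f:[n]\to[n]$ and $g:[m]\to[m]$, $f\bullet g:[n+m]\to[n+m]$ is the shifted concatenation: $(f\bullet g)(i)=f(i)$ for $i\le n$ and $(f\bullet g)(n+i)=g(i)+n$. For $I\subseteq[n]$, $f^I:I\to I$ is defined by $f^I(x)=f(x)$ if $f(x)\in I$ and $f^I(x)=x$ otherwise; if $|I|=k$ and $\tau_I:I\to[k]$ is the increasing bijection, $\mathrm{std}(f^I)=\tau_I\circ f^I\circ\tau_I^{-1}$. $I$ is an ideal of $f$, written $I\models f$, if $f^{-1}(I)\subseteq I$. $B=\{b_{ij}:i\neq j\}$ is a disjoint copy of $A$ with the same relation; $A\oplus B$ is the disjoint union with the relations on $A$ and on $B$ plus $a\prec b$ for all $a\in A,b\in B$ (never $b\prec a$); $\mathbf S^f(A\oplus B)$ is the sum of $f$-compatible words over $A\oplus B$. $\mathbf S^{\emptyset}=1$ for the empty function. *)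

(* Defs.v *)
From HB Require Import structures.
From mathcomp Require Import all_boot all_order all_algebra.
Set Implicit Arguments. Unset Strict Implicit. Unset Printing Implicit Defensive.
Import GRing.Theory.
Local Open Scope ring_scope.

Definition letter := {p : nat * nat | (p.1 != p.2) && (0 < p.1)%N && (0 < p.2)%N}.

Definition precA : rel letter := fun x y => (val x).2 == (val y).1.

Definition precAB : rel (letter + letter) := fun x y =>
  match x, y with
  | inl a, inl a' => precA a a'
  | inr b, inr b' => precA b b'
  | inl _, inr _ => true
  | inr _, inl _ => false
  end.

Definition endo := {n : nat & {ffun 'I_n -> 'I_n}}.
Definition edeg (f : endo) : nat := tag f.

Definition eempty : endo :=
  Tagged (fun n => {ffun 'I_n -> 'I_n}) [ffun i : 'I_0 => i].

Definition econcat (f g : endo) : endo :=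
  Tagged (fun n => {ffun 'I_n -> 'I_n})
    [ffun i : 'I_(tag f + tag g) =>
       match split i with
       | inl j => lshift (tag g) (tagged f j)
       | inr j => rshift (tag f) (tagged g j)
       end].

Definition ideal n (f : {ffun 'I_n -> 'I_n}) (I : {set 'I_n}) : bool :=
  f @^-1: I \subset I.

(* std(f^I) : k = #|I|, tau_I the increasing bijection I -> [k]
   (tau_I y = index of y in the increasing enumeration of I) *)
Definition estd n (f : {ffun 'I_n -> 'I_n}) (I : {set 'I_n}) : endo :=
  Tagged (fun n => {ffun 'I_n -> 'I_n})
    [ffun i : 'I_#|I| =>
       let x := @enum_val _ (pred_of_set I) i in
       let y := if f x \in I then f x else x in
       insubd i (index y (enum I))].

Definition oprec (T : Type) (r : rel T) (x y : option T) : bool :=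
  match x, y with Some a, Some b => r a b | _, _ => false end.

Definition compatible (T : eqType) (r : rel T) n (f : {ffun 'I_n -> 'I_n})
    (w : seq T) : bool :=
  (size w == n) &&
  [forall j : 'I_n, (f j != j) ==> oprec r (onth w (f j)) (onth w j)].

(* a series in K<<T>> is its coefficient function on words *)
Definition Sf (K : fieldType) (T : eqType) (r : rel T) (f : endo) : seq T -> K :=
  fun w => (compatible r (tagged f) w)%:R.

Definition smul (K : fieldType) (T : Type) (F G : seq T -> K) : seq T -> K :=
  fun w => \sum_(k < (size w).+1) F (take k w) * G (drop k w).

Definition sone (K : fieldType) (T : eqType) : seq T -> K :=
  fun w => (w == [::])%:R.

(* all shuffles of u (tagged inl) and v (tagged inr): the words over A (+) B
   whose A-letters read u and whose B-letters read v.  The coefficient of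
   u v in the image of F(A(+)B) in the algebra where A-letters commute with
   B-letters is the sum of F over these words. *)
Fixpoint shuffles (T : Type) (u v : seq T) : seq (seq (T + T)) :=
  match u with
  | [::] => [:: map inr v]
  | a :: u' =>
      let fix sh (v : seq T) : seq (seq (T + T)) :=
        match v with
        | [::] => [:: map inl u]
        | b :: v' => map (cons (inl a)) (shuffles u' v) ++ map (cons (inr b)) (sh v')
        end in sh v
  end.

Definition cop (f : endo) : seq (endo * endo) :=
  [seq (estd (tagged f) (~: J), estd (tagged f) J)
     | J <- enum [set J : {set 'I_(tag f)} | ideal (tagged f) J]].

Section Formal.
Variable K : fieldType.

(* a formal linear combination; two of them are identified when coefficients agree *)
Definition coef (X : eqType) (s : seq (X * K)) (x : X) : K :=
  \sum_(p <- s | p.1 == x) p.2.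
Definition feq (X : eqType) (s t : seq (X * K)) : Prop :=
  forall x, coef s x = coef t x.

Definition mulE (s t : seq (endo * K)) : seq (endo * K) :=
  [seq (econcat p.1 q.1, p.2 * q.2) | p <- s, q <- t].
Definition unitE : seq (endo * K) := [:: (eempty, 1)].
Definition scaleE (c : K) (s : seq (endo * K)) := [seq (p.1, c * p.2) | p <- s].

Definition copE (s : seq (endo * K)) : seq ((endo * endo) * K) :=
  flatten [seq [seq (pq, p.2) | pq <- cop p.1] | p <- s].
Definition counitE (s : seq (endo * K)) : K :=
  \sum_(p <- s | edeg p.1 == 0%N) p.2.

Definition mul2 (x y : seq ((endo * endo) * K)) : seq ((endo * endo) * K) :=
  [seq ((econcat a.1.1 b.1.1, econcat a.1.2 b.1.2), a.2 * b.2) | a <- x, b <- y].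
Definition unit2 : seq ((endo * endo) * K) := [:: ((eempty, eempty), 1)].
Definition cop_id (x : seq ((endo * endo) * K)) : seq ((endo * endo * endo) * K) :=
  flatten [seq [seq ((q.1, q.2, a.1.2), a.2) | q <- cop a.1.1] | a <- x].
Definition id_cop (x : seq ((endo * endo) * K)) : seq ((endo * endo * endo) * K) :=
  flatten [seq [seq ((a.1.1, q.1, q.2), a.2) | q <- cop a.1.2] | a <- x].
Definition counit_id (x : seq ((endo * endo) * K)) : seq (endo * K) :=
  [seq (a.1.2, (edeg a.1.1 == 0%N)%:R * a.2) | a <- x].
Definition id_counit (x : seq ((endo * endo) * K)) : seq (endo * K) :=
  [seq (a.1.1, (edeg a.1.2 == 0%N)%:R * a.2) | a <- x].
Definition flip2 (x : seq ((endo * endo) * K)) : seq ((endo * endo) * K) :=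
  [seq ((a.1.2, a.1.1), a.2) | a <- x].

Definition linext (S : endo -> seq (endo * K)) (s : seq (endo * K)) : seq (endo * K) :=
  flatten [seq scaleE p.2 (S p.1) | p <- s].
Definition conv_S_id (S : endo -> seq (endo * K)) (s : seq (endo * K)) :=
  flatten [seq mulE (scaleE a.2 (S a.1.1)) [:: (a.1.2, 1)] | a <- copE s].
Definition conv_id_S (S : endo -> seq (endo * K)) (s : seq (endo * K)) :=
  flatten [seq mulE [:: (a.1.1, a.2)] (S a.1.2) | a <- copE s].

Definition EFSym_graded_hopf : Prop :=
  (forall s t u, feq (mulE (mulE s t) u) (mulE s (mulE t u))) /\
  (forall s, feq (mulE unitE s) s /\ feq (mulE s unitE) s) /\
  (forall s, feq (cop_id (copE s)) (id_cop (copE s))) /\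
  (forall s, feq (counit_id (copE s)) s /\ feq (id_counit (copE s)) s) /\
  ((forall s t, feq (copE (mulE s t)) (mul2 (copE s) (copE t))) /\ feq (copE unitE) unit2) /\
  ((forall s t, counitE (mulE s t) = counitE s * counitE t) /\ counitE unitE = 1) /\
  ((forall f g, edeg (econcat f g) = (edeg f + edeg g)%N) /\
   (forall f p, p \in cop f -> (edeg p.1 + edeg p.2)%N = edeg f)) /\
  (exists S : endo -> seq (endo * K),
     forall s, feq (conv_S_id S s) (scaleE (counitE s) unitE) /\
               feq (conv_id_S S s) (scaleE (counitE s) unitE)) /\
  (exists s, ~ feq (copE s) (flip2 (copE s))).

End Formal.

(* Main.v *)
Require Import Defs.
From HB Require Import structures.
From mathcomp Require Import all_boot all_order all_algebra.
Import GRing.Theory.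
Local Open Scope ring_scope.
Set Implicit Arguments. Unset Strict Implicit. Unset Printing Implicit Defensive.

(** The word whose [j]-th letter is a_{f(j),j} (with a fresh source when [f j = j])
    is compatible with [g] exactly when [g] arises from [f] by turning some points
    into fixed points, so the matrix of coefficients is unitriangular for the number
    of moved points: this gives linear independence.

    A word over A (+) B is determined by its A-letters, its B-letters and the set
    [I] of positions of the latter; since never b < a, compatibility forces [I] to be
    an ideal and then splits into compatibility on [I] and on its complement.

    Coassociativity amounts to std (std (f^A)^B) = std (f^B): both iterated
    coproducts range over pairs of nested ideals.  As the coproduct is graded and
    connected, left and right antipodes are obtained by recursion on the degree, and
    coincide by associativity of convolution. *)

(** * Standardization *)

(** The restriction f^A kept as a function on all of ['I_n], so that no subtype is involved; only
    its values on [A] matter. *)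
Definition rfun n (f : {ffun 'I_n -> 'I_n}) (A : {set 'I_n}) (x : 'I_n) : 'I_n :=
  if f x \in A then f x else x.

(** Comparing arguments and values as natural numbers avoids casts along the equality of degrees. *)
Lemma endo_ext (f g : endo) : tag f = tag g ->
  (forall (i : 'I_(tag f)) (j : 'I_(tag g)), i = j :> nat ->
     tagged f i = tagged g j :> nat) -> f = g.
Proof.
case: f g => [n f] [m g] /= nm; case: m / nm g => g fg.
by congr (Tagged _ _); apply/ffunP => i; apply/val_inj/fg.
Qed.

Lemma enum_set_filter n (A : {set 'I_n}) : enum A = [seq i <- enum 'I_n | i \in A].
Proof. by rewrite enumT. Qed.

Lemma sorted_enum_ord n (A : {set 'I_n}) : sorted ltn (map val (enum A)).
Proof.
rewrite enum_set_filter sorted_map; apply: sorted_filter; first by move=> x y z; apply: ltn_trans.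
by have := iota_ltn_sorted 0 n; rewrite -val_enum_ord sorted_map.
Qed.

(** Both lists are strictly increasing with the same elements, hence equal. *)
Lemma enum_ord_mono m n (h : 'I_m -> 'I_n) (A : {set 'I_n}) :
  {homo h : i j / (i < j)%N} -> (forall x, (x \in A) = (x \in codom h)) ->
  enum A = map h (enum 'I_m).
Proof.
move=> hm hA; apply: (inj_map val_inj).
apply: (irr_sorted_eq ltn_trans ltnn); first exact: sorted_enum_ord.
- have := iota_ltn_sorted 0 m; rewrite -val_enum_ord -map_comp !sorted_map.
  by apply: sub_sorted => i j; apply: hm.
- by apply: eq_mem_map => x; rewrite mem_enum hA.
Qed.

Lemma homo_ltn_inj m n (h : 'I_m -> 'I_n) :
  {homo h : i j / (i < j)%N} -> injective h.
Proof.
move=> hm i j hij; apply/val_inj; case: (ltngtP i j) => // /hm;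
by rewrite hij ltnn.
Qed.

(** An increasing parametrization [h] of [A] must be the inverse of tau_A, so a [g] that [h]
    intertwines with f^A is the standardization. Later identities between standardizations only have
    to exhibit [h]. *)
Lemma estd_uniq m n (f : {ffun 'I_n -> 'I_n}) (g : {ffun 'I_m -> 'I_m})
    (h : 'I_m -> 'I_n) (A : {set 'I_n}) :
  {homo h : i j / (i < j)%N} -> (forall x, (x \in A) = (x \in codom h)) ->
  (forall i, rfun f A (h i) = h (g i)) ->
  estd f A = Tagged (fun n => {ffun 'I_n -> 'I_n}) g.
Proof.
move=> hm hA hf; have eA := enum_ord_mono hm hA.
have cA : #|A| = m by rewrite cardE eA size_map size_enum_ord.
apply: endo_ext => //= i j ij; rewrite ffunE.
have -> : enum_val i = h j.
  rewrite (enum_val_nth (h j)) eA (nth_map j) ?size_enum_ord ?ij //.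
  by rewrite nth_ord_enum.
rewrite -/(rfun f A (h j)) hf eA index_map; last exact: homo_ltn_inj.
(* The index is in range, so [insubd] returns it and not its default. *)
have gA : (g j < #|A|)%N by rewrite cA.
by rewrite index_enum_ord val_insubd gA.
Qed.

Lemma enum_val_homo n (A : {set 'I_n}) :
  {homo (@enum_val _ (pred_of_set A)) : i j / (i < j)%N}.
Proof.
move=> i j ij; have [x0 _] : exists x0 : 'I_n, true by exists (enum_val i).
rewrite !(enum_val_nth x0).
have sz : forall k : 'I_#|A|, (k < size (map val (enum A)))%N.
  by move=> k; rewrite size_map -cardE.
have := sorted_ltn_nth ltn_trans 0%N (sorted_enum_ord A) i j (sz i) (sz j) ij.
by rewrite !(nth_map x0) // -cardE.
Qed.

Lemma codom_enum_val n (A : {set 'I_n}) x :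
  (x \in A) = (x \in codom (@enum_val _ (pred_of_set A))).
Proof.
apply/idP/codomP => [xA|[i ->]]; last exact: enum_valP.
by exists (enum_rank_in xA x); rewrite enum_rankK_in.
Qed.

Lemma rfun_in n (f : {ffun 'I_n -> 'I_n}) (A : {set 'I_n}) x : x \in A -> rfun f A x \in A.
Proof. by rewrite /rfun; case: ifP. Qed.

(** The relation required by [estd_uniq], for [h] the enumeration of [A]. *)
Lemma estd_enum_val n (f : {ffun 'I_n -> 'I_n}) (A : {set 'I_n}) i :
  rfun f A (@enum_val _ (pred_of_set A) i) = enum_val (tagged (estd f A) i).
Proof.
rewrite ffunE /= -/(rfun _ _ _); set y := rfun _ _ _.
have yA : y \in A by apply/rfun_in/enum_valP.
have ly : (index y (enum A) < #|A|)%N by rewrite cardE index_mem mem_enum.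
rewrite (enum_val_nth (enum_val i)) val_insubd ly.
by rewrite nth_index // mem_enum.
Qed.

Lemma estd_setT (f : endo) : estd (tagged f) [set: _] = f.
Proof.
case: f => n f; apply: (@estd_uniq _ _ _ _ id) => //= [x|i].
  by rewrite inE codom_f.
by rewrite /rfun inE.
Qed.

Lemma edeg_estd n (f : {ffun 'I_n -> 'I_n}) A : edeg (estd f A) = #|A|.
Proof. by []. Qed.

Lemma edeg0 (f : endo) : edeg f = 0%N -> f = eempty.
Proof.
move=> f0; apply: endo_ext => //= i; case: f f0 i => n f /= f0 i.
by exfalso; move: (ltn_ord i); rewrite [in X in (_ < X)%N]f0.
Qed.

(** * Iterated standardization: subsets of a renumbered subset *)

Definition lift_set n (A : {set 'I_n}) (B : {set 'I_#|A|}) : {set 'I_n} :=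
  @enum_val _ (pred_of_set A) @: B.

Lemma mem_lift_set n (A : {set 'I_n}) (B : {set 'I_#|A|}) i :
  (enum_val i \in lift_set B) = (i \in B).
Proof. exact/mem_imset/enum_val_inj. Qed.

Lemma lift_set_sub n (A : {set 'I_n}) (B : {set 'I_#|A|}) : lift_set B \subset A.
Proof. by apply/subsetP => x /imsetP[i _ ->]; apply: enum_valP. Qed.

Lemma lift_setC n (A : {set 'I_n}) (B : {set 'I_#|A|}) :
  lift_set (~: B) = A :\: lift_set B.
Proof.
apply/setP => x; rewrite inE; case xA: (x \in A); last first.
  by rewrite andbF; apply: contraFF xA => /(subsetP (lift_set_sub _)).
move: xA; rewrite codom_enum_val => /codomP[i ->].
by rewrite !mem_lift_set inE andbT.
Qed.

(** The composite of the two enumerations is increasing with image [lift_set B], so [estd_uniq]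
    applies to it. *)
Lemma estd_estd n (f : {ffun 'I_n -> 'I_n}) (A : {set 'I_n}) (B : {set 'I_#|A|}) :
  estd (tagged (estd f A)) B = estd f (lift_set B).
Proof.
set g := estd f A; symmetry.
rewrite -[RHS]/(Tagged _ (tagged (estd (tagged g) B))).
apply: (@estd_uniq _ _ _ _ (enum_val \o @enum_val _ (pred_of_set B))).
- by move=> i j ij; do 2!apply: enum_val_homo.
- move=> x; apply/imsetP/codomP => [[i + ->]|[i ->]]; last first.
    by exists (enum_val i) => //; apply: enum_valP.
  by rewrite codom_enum_val => /codomP[j ->]; exists j.
move=> i /=; rewrite -estd_enum_val.
set j := enum_val i; have jB : j \in B by apply: enum_valP.
have e := estd_enum_val f j; rewrite -/g in e.
rewrite [rfun (tagged g) B j]/rfun fun_if -(mem_lift_set B) -e /rfun.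
(* A point sent outside [A] is fixed by the first restriction, and also by the direct one, since the
   lift of [B] lies in [A]. *)
case: (boolP (f _ \in A)) => // fA; rewrite if_same ifN //.
by apply: contraNN fA; apply: (subsetP (lift_set_sub _)).
Qed.

Lemma idealP n (f : {ffun 'I_n -> 'I_n}) (I : {set 'I_n}) :
  reflect (forall x, f x \in I -> x \in I) (ideal f I).
Proof.
apply: (iffP subsetP) => H x; have := H x; rewrite inE; exact.
Qed.

(** Points that the restriction to [A] makes fixed impose no condition; what remains is the ideal
    condition of [f] at the points of [A]. *)
Lemma ideal_estd n (f : {ffun 'I_n -> 'I_n}) (A : {set 'I_n}) (B : {set 'I_#|A|}) :
  reflect (forall x, x \in A -> f x \in lift_set B -> x \in lift_set B)
          (ideal (tagged (estd f A)) B).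
Proof.
apply: (iffP (idealP _ _)) => H.
  move=> x; rewrite codom_enum_val => /codomP[i ->].
  rewrite mem_lift_set => fB; apply: H.
  rewrite -mem_lift_set -estd_enum_val /rfun.
  by rewrite (subsetP (lift_set_sub _) _ fB).
move=> i; rewrite -!mem_lift_set -estd_enum_val /rfun.
by case: ifP => // _; apply/H/enum_valP.
Qed.

(** Lifting is a bijection onto the subsets of [A], with inverse the preimage under the
    enumeration. *)
Lemma big_lift_set (V : nmodType) n (A : {set 'I_n}) (P : pred {set 'I_n})
    (F : {set 'I_n} -> V) :
  \sum_(B : {set 'I_#|A|} | P (lift_set B)) F (lift_set B) =
  \sum_(B : {set 'I_n} | (B \subset A) && P B) F B.
Proof.
have preimK (B : {set 'I_n}) : B \subset A ->
    lift_set (@enum_val _ (pred_of_set A) @^-1: B) = B.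
  move=> BA; apply/setP => x; case xA: (x \in A); last first.
    by rewrite (contraFF (subsetP BA x)) //; apply: contraFF xA => /(subsetP (lift_set_sub _)).
  by move: xA; rewrite codom_enum_val => /codomP[i ->]; rewrite mem_lift_set inE.
rewrite [RHS](reindex_onto (@lift_set n A) (fun B => @enum_val _ (pred_of_set A) @^-1: B)).
  apply: eq_bigl => B; rewrite lift_set_sub /=; case: (P _) => //=.
  by apply/esym/eqP/setP => i; rewrite inE mem_lift_set.
by move=> B /andP[BA _]; apply: preimK.
Qed.

(** * Ideals and the coproduct *)

Lemma big_cop (V : nmodType) (f : endo) (F : endo * endo -> V) :
  \sum_(p <- cop f) F p =
  \sum_(J : {set 'I_(tag f)} | ideal (tagged f) J)
    F (estd (tagged f) (~: J), estd (tagged f) J).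
Proof. by rewrite big_map big_enum; apply: eq_bigl => J; rewrite inE. Qed.

Lemma setUD_disj (T : finType) (I J : {set T}) : J \subset ~: I -> (I :|: J) :\: I = J.
Proof.
move=> /subsetP sJ; apply/setP => x; rewrite !inE; case: (boolP (x \in I)) => //= xI.
by apply/esym/negP => /sJ; rewrite inE xI.
Qed.

(** Both sides sum over nested ideals, written I and I ∪ J with J disjoint from I. An arbitrary [F]
    is allowed so that the identity applies to any test function and to convolutions. *)
Lemma cop_coassoc (V : nmodType) (F : endo -> endo -> endo -> V) (f : endo) :
  \sum_(p <- cop f) \sum_(q <- cop p.1) F q.1 q.2 p.2 =
  \sum_(p <- cop f) \sum_(q <- cop p.2) F p.1 q.1 q.2.
Proof.
case: f => n f; rewrite !big_cop /=.
(* The ideals of the restriction to the complement of [I] are the [J] outside [I] for which I ∪ J is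
   an ideal of [f]. *)
transitivity (\sum_(I : {set 'I_n} | ideal f I)
  \sum_(J : {set 'I_n} | (J \subset ~: I) && ideal f (I :|: J))
    F (estd f (~: (I :|: J))) (estd f J) (estd f I)).
  apply: eq_bigr => I /idealP idI; rewrite big_cop -big_lift_set.
  apply: eq_big => [J|J _]; last first.
    by rewrite !estd_estd lift_setC setCU -setDE.
  apply/ideal_estd/idealP => H x; rewrite !inE.
    case/orP => [/idI->//|fJ]; case xI: (x \in I) => //=.
    by apply: H => //; rewrite inE xI.
  by move=> xI fJ; have := H x; rewrite !inE fJ orbT (negPf xI); apply.
(* The ideals of the restriction to an ideal [I] are the ideals of [f] inside [I]. *)
transitivity (\sum_(I : {set 'I_n} | ideal f I)
  \sum_(J : {set 'I_n} | (J \subset I) && ideal f J)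
    F (estd f (~: I)) (estd f (I :\: J)) (estd f J)); last first.
  apply: eq_bigr => I /idealP idI; rewrite big_cop -big_lift_set.
  apply: eq_big => [J|J _]; last by rewrite !estd_estd lift_setC.
  apply/idealP/ideal_estd => H x; first by move=> _; apply: H.
  by move=> fJ; apply: H => //; apply/idI/(subsetP (lift_set_sub J)).
(* The smaller ideal becomes the outer index, and the larger one is then rewritten as the smaller
   one plus a disjoint set. *)
rewrite [RHS](exchange_big_dep (fun J => ideal f J)) /=; last by move=> I J _ /andP[].
apply: eq_bigr => I idI.
rewrite [RHS](reindex_onto (fun J => I :|: J) (fun J => J :\: I)) /=; last first.
  by move=> J /andP[_ /andP[sIJ _]]; apply/setP => x;
    rewrite !inE; case xI: (x \in I) => //=; rewrite (subsetP sIJ).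
have e (J : {set 'I_n}) : (J \subset ~: I) = ((I :|: J) :\: I == J).
  apply/idP/eqP => [|<-]; first exact: setUD_disj.
  by apply/subsetP => x; rewrite !inE => /andP[].
apply: eq_big => [J|J /andP[sJ _]].
  by rewrite e subsetUl idI !andbT andbC.
by rewrite setUD_disj.
Qed.

(** The empty ideal alone gives a second factor of degree 0, and its complement restores [f]. *)
Lemma cop_counitr (V : nmodType) (F : endo * endo -> V) (f : endo) :
  \sum_(p <- cop f | edeg p.2 == 0%N) F p = F (f, eempty).
Proof.
rewrite big_mkcond big_cop -big_mkcondr /= (big_pred1 set0) => [|J].
  by rewrite setC0 estd_setT [X in (_, X)]edeg0 // edeg_estd cards0.
rewrite cards_eq0; case: eqP => [->|nJ]; last by rewrite andbF; apply/esym/eqP.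
by rewrite andbT /= eqxx; apply/idealP => x; rewrite !inE.
Qed.

Lemma cop_counitl (V : nmodType) (F : endo * endo -> V) (f : endo) :
  \sum_(p <- cop f | edeg p.1 == 0%N) F p = F (eempty, f).
Proof.
rewrite big_mkcond big_cop -big_mkcondr /= (big_pred1 setT) => [|J].
  by rewrite setCT estd_setT [X in (X, _)]edeg0 // edeg_estd cards0.
have -> : (#|~: J| == 0)%N = (J == setT).
  by rewrite cards_eq0 -setCT (inj_eq (can_inj (@setCK _))).
case: eqP => [->|nJ]; last by rewrite andbF; apply/esym/eqP.
by rewrite andbT /= eqxx; apply/idealP => x; rewrite !inE.
Qed.

Lemma cop_edeg f p : p \in cop f -> (edeg p.1 + edeg p.2)%N = edeg f.
Proof.
case/mapP => J _ -> /=; rewrite addnC cardsC; exact: card_ord.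
Qed.

(** * Shifted concatenation *)

Lemma split_lshift m n (i : 'I_m) : split (lshift n i) = inl i.
Proof. exact: (unsplitK (inl i)). Qed.

Lemma split_rshift m n (i : 'I_n) : split (rshift m i) = inr i.
Proof. exact: (unsplitK (inr i)). Qed.

Lemma econcat_lshift (f g : endo) i :
  tagged (econcat f g) (lshift _ i) = lshift _ (tagged f i).
Proof. by rewrite ffunE split_lshift. Qed.

Lemma econcat_rshift (f g : endo) i :
  tagged (econcat f g) (rshift _ i) = rshift _ (tagged g i).
Proof. by rewrite ffunE split_rshift. Qed.

(* Extending [f] by the identity to all of nat makes concatenations of different
   bracketings comparable without casts. *)
Definition ev (f : endo) (k : nat) : nat :=
  if insub k is Some i then tagged f i else k.

Lemma ev_ord (f : endo) (i : 'I_(tag f)) : ev f i = tagged f i.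
Proof. by rewrite /ev valK. Qed.

Lemma ev_ext (f g : endo) : edeg f = edeg g -> ev f =1 ev g -> f = g.
Proof. by move=> fg H; apply: endo_ext => // i j ij; rewrite -!ev_ord ij. Qed.

(** The formula also holds beyond the total degree, where all the extensions are the identity. *)
Lemma ev_econcat (f g : endo) k :
  ev (econcat f g) k = if (k < edeg f)%N then ev f k else (edeg f + ev g (k - edeg f))%N.
Proof.
rewrite {1}/ev; case: insubP => [i _ <-|/= kfg].
  rewrite -[i]splitK; case: (split i) => j /=.
    by rewrite econcat_lshift /= ltn_ord ev_ord.
  rewrite econcat_rshift /= ltnNge leq_addr /=.
  by rewrite (_ : (edeg f + j - edeg f)%N = j) ?addKn // ev_ord.
rewrite -leqNgt in kfg; rewrite ltnNge (leq_trans (leq_addr _ _) kfg) /=.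
rewrite /ev insubF ?subnKC ?(leq_trans (leq_addr _ _) kfg) //.
by rewrite ltnNge leq_subRL ?kfg // (leq_trans (leq_addr _ _) kfg).
Qed.

Lemma econcatA : associative econcat.
Proof.
move=> f g h; apply: ev_ext => [|k]; first exact: addnA.
rewrite !ev_econcat /= !/(edeg (econcat _ _)) /=.
case: (ltnP k (edeg f)) => kf; first by rewrite (leq_trans kf (leq_addr _ _)).
rewrite ltn_subLR // -/(edeg f) -/(edeg g); case: ifP => _ //.
by rewrite addnA subnDA.
Qed.

Lemma econcat0e : left_id eempty econcat.
Proof.
by move=> f; apply: ev_ext => // k; rewrite ev_econcat /= subn0.
Qed.

Lemma econcate0 : right_id eempty econcat.
Proof.
move=> f; apply: ev_ext => [|k]; first exact: addn0.
rewrite ev_econcat; case: ltnP => // fk.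
rewrite /ev !insubF ?subnKC // ltnNge ?fk //.
Qed.

(** * Subsets and ideals of a concatenation *)

Definition set_sum n m (I : {set 'I_n}) (J : {set 'I_m}) : {set 'I_(n + m)} :=
  [set x | match split x with inl a => a \in I | inr b => b \in J end].

Lemma set_suml n m (I : {set 'I_n}) (J : {set 'I_m}) i :
  (lshift m i \in set_sum I J) = (i \in I).
Proof. by rewrite inE split_lshift. Qed.

Lemma set_sumr n m (I : {set 'I_n}) (J : {set 'I_m}) i :
  (rshift n i \in set_sum I J) = (i \in J).
Proof. by rewrite inE split_rshift. Qed.

Lemma set_sumC n m (I : {set 'I_n}) (J : {set 'I_m}) :
  ~: set_sum I J = set_sum (~: I) (~: J).
Proof. by apply/setP => x; rewrite !inE; case: split => i; rewrite inE. Qed.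

Lemma big_set_sum (V : nmodType) n m (F : {set 'I_(n + m)} -> V) :
  \sum_X F X = \sum_I \sum_J F (set_sum I J).
Proof.
rewrite pair_big /= (reindex (fun p : {set 'I_n} * {set 'I_m} => set_sum p.1 p.2)) //.
exists (fun X : {set 'I_(n + m)} => (@lshift n m @^-1: X, @rshift n m @^-1: X)).
  move=> [I J] _ /=; congr (_, _); apply/setP => x.
    by rewrite inE set_suml.
  by rewrite inE set_sumr.
move=> X _ /=; apply/setP => x; rewrite -[x]splitK; case: (split x) => i /=.
  by rewrite set_suml inE.
by rewrite set_sumr inE.
Qed.

Lemma ideal_econcat (f g : endo) I J :
  ideal (tagged (econcat f g)) (set_sum I J) = ideal (tagged f) I && ideal (tagged g) J.
Proof.
apply/idealP/andP => [H|[/idealP Hf /idealP Hg] x].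
  split; apply/idealP => x.
    by have := H (lshift _ x); rewrite econcat_lshift !set_suml.
  by have := H (rshift _ x); rewrite econcat_rshift !set_sumr.
rewrite -[x]splitK; case: (split x) => i /=.
  by rewrite econcat_lshift !set_suml; apply: Hf.
by rewrite econcat_rshift !set_sumr; apply: Hg.
Qed.

Lemma estd_econcat (f g : endo) I J :
  estd (tagged (econcat f g)) (set_sum I J) =
  econcat (estd (tagged f) I) (estd (tagged g) J).
Proof.
set fI := estd _ I; set gJ := estd _ J.
rewrite -[RHS]/(Tagged _ (tagged (econcat fI gJ))).
(* The increasing enumeration of [set_sum I J] juxtaposes those of [I] and [J]. *)
pose h (i : 'I_(tag fI + tag gJ)) : 'I_(tag f + tag g) := match split i with
  | inl a => lshift _ (@enum_val _ (pred_of_set I) a)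
  | inr b => rshift _ (@enum_val _ (pred_of_set J) b) end.
have hl i : h (lshift _ i) = lshift _ (enum_val i) by rewrite /h split_lshift.
have hr i : h (rshift _ i) = rshift _ (enum_val i) by rewrite /h split_rshift.
apply: (@estd_uniq _ _ _ _ h).
- move=> i j; rewrite -[i]splitK -[j]splitK.
  case: (split i) => a; case: (split j) => b; rewrite ?hl ?hr /=.
  + exact: enum_val_homo.
  + by move=> _; rewrite ltn_addr.
  + by rewrite ltnNge (leq_trans (ltnW (ltn_ord b))) ?leq_addr.
  + by rewrite !ltn_add2l; apply: enum_val_homo.
- move=> x; apply/idP/codomP => [|[i ->]].
    rewrite -[x]splitK; case: (split x) => a /=; rewrite (set_suml, set_sumr).
      by rewrite codom_enum_val => /codomP[i ->]; exists (lshift _ i); rewrite hl.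
    by rewrite codom_enum_val => /codomP[i ->]; exists (rshift _ i); rewrite hr.
  rewrite -[i]splitK; case: (split i) => a.
    by rewrite hl set_suml; apply: enum_valP.
  by rewrite hr set_sumr; apply: enum_valP.
- move=> i; rewrite -[i]splitK; case: (split i) => a.
    rewrite hl econcat_lshift hl -estd_enum_val /rfun econcat_lshift set_suml.
    by case: ifP.
  rewrite hr econcat_rshift hr -estd_enum_val /rfun econcat_rshift set_sumr.
  by case: ifP.
Qed.

(** Multiplicativity of the coproduct: ideals of a concatenation are pairs of ideals, and complement
    and standardization act blockwise. *)
Lemma cop_econcat (V : nmodType) (f g : endo) (F : endo * endo -> V) :
  \sum_(p <- cop (econcat f g)) F p =
  \sum_(p <- cop f) \sum_(q <- cop g) F (econcat p.1 q.1, econcat p.2 q.2).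
Proof.
rewrite !big_cop big_mkcond big_set_sum /= [RHS]big_mkcond; apply: eq_bigr => I _.
rewrite big_cop; case: ifP => fI; last first.
  by rewrite big1 // => J _; rewrite ideal_econcat fI.
rewrite [RHS]big_mkcond; apply: eq_bigr => J _.
by rewrite ideal_econcat fI /= set_sumC !estd_econcat.
Qed.

Lemma cop_eempty (V : nmodType) (F : endo * endo -> V) :
  \sum_(p <- cop eempty) F p = F (eempty, eempty).
Proof.
(* In total degree 0 every term has a second factor of degree 0, so the counit identity already
   covers the whole sum. *)
rewrite -cop_counitr big_seq [RHS]big_seq_cond; apply: eq_bigl => p.
case pc: (p \in _) => //=; have := cop_edeg pc.
by move/eqP; rewrite addn_eq0 => /andP[].
Qed.

(** * The Hopf algebra axioms *)

Section Pairing.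
Variable K : fieldType.

(** Linear extension of a test function [phi]. Equality of formal combinations is tested by all
    pairings, which turns each Hopf axiom into an identity between finite sums. *)
Definition pairing (X : Type) (s : seq (X * K)) (phi : X -> K) : K :=
  \sum_(p <- s) p.2 * phi p.1.

(** A coefficient is the pairing with an indicator function; conversely, a pairing is recovered from
    the coefficients. *)
Lemma feq_pairing (X : eqType) (s t : seq (X * K)) :
  feq s t <-> forall phi, pairing s phi = pairing t phi.
Proof.
split=> [st phi|H x]; last first.
  have coefE u : coef u x = pairing u (fun y => (y == x)%:R).
    by rewrite /coef big_mkcond; apply: eq_bigr => p _;
      case: (p.1 == x); rewrite ?mulr1 ?mulr0.
  by rewrite !coefE.
(* A duplicate-free list containing both supports, over which both pairings can be expanded. *)
pose r := undup (map fst s ++ map fst t).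
have pE (u : seq (X * K)) : {subset map fst u <= r} ->
    pairing u phi = \sum_(x <- r) coef u x * phi x.
  move=> ur; under eq_bigr do rewrite /coef big_distrl big_mkcond /=.
  rewrite exchange_big /= /pairing !big_seq; apply: eq_bigr => p pu.
  rewrite (bigD1_seq p.1) ?undup_uniq /= ?ur ?map_f // eqxx.
  by rewrite big1 ?addr0 // => x; rewrite eq_sym => /negPf->.
rewrite !pE => [|x xs|x xs]; try by rewrite mem_undup mem_cat xs ?orbT.
by apply: eq_bigr => x _; rewrite st.
Qed.

Section Linearity.
Variables X Y Z : Type.
Implicit Types (s : seq (X * K)) (t : seq (Y * K)).

Lemma eq_pairing s phi psi : phi =1 psi -> pairing s phi = pairing s psi.
Proof. by move=> e; apply: eq_bigr => p _; rewrite e. Qed.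

Lemma pairingZ s c phi : pairing s (fun x => c * phi x) = c * pairing s phi.
Proof. by rewrite /pairing big_distrr; apply: eq_bigr => p _; apply: mulrCA. Qed.

Lemma pairing_sum s (r : seq Z) (P : pred Z) F :
  pairing s (fun x => \sum_(z <- r | P z) F z x) = \sum_(z <- r | P z) pairing s (F z).
Proof.
by rewrite /pairing exchange_big; apply: eq_bigr => p _; rewrite big_distrr.
Qed.

Lemma pairing_flatten_map (r : seq (Y * K)) (S : Y * K -> seq (X * K)) phi :
  pairing (flatten [seq S a | a <- r]) phi = \sum_(a <- r) pairing (S a) phi.
Proof. by rewrite /pairing big_flatten big_map. Qed.

End Linearity.

Lemma pairing_exchange (X Y : Type) (s : seq (X * K)) (t : seq (Y * K)) F :
  pairing s (fun x => pairing t (F x)) = pairing t (fun y => pairing s (F^~ y)).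
Proof.
rewrite -[LHS]/(\sum_(p <- s) p.2 * pairing t (F p.1)).
under eq_bigr do rewrite -pairingZ.
by rewrite -pairing_sum.
Qed.

(** * Structure maps transposed to test functions *)

Lemma pairing_mulE (s t : seq (endo * K)) phi :
  pairing (mulE s t) phi = pairing s (fun a => pairing t (fun b => phi (econcat a b))).
Proof.
rewrite /pairing big_allpairs_dep; apply: eq_bigr => p _.
by rewrite big_distrr; apply: eq_bigr => q _; rewrite /= mulrA.
Qed.

Lemma pairing1 (X : Type) (x : X) c phi : pairing [:: (x, c)] phi = c * phi x.
Proof. exact: big_seq1. Qed.

Lemma pairing_scaleE c (s : seq (endo * K)) phi :
  pairing (scaleE c s) phi = c * pairing s phi.
Proof. by rewrite /pairing big_map big_distrr; apply: eq_bigr => p _; rewrite /= mulrA. Qed.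

Lemma pairing_copE (s : seq (endo * K)) phi :
  pairing (copE s) phi = pairing s (fun f => \sum_(q <- cop f) phi q).
Proof.
rewrite pairing_flatten_map; apply: eq_bigr => p _.
by rewrite /pairing big_map big_distrr.
Qed.

Lemma pairing_mul2 (x y : seq ((endo * endo) * K)) phi :
  pairing (mul2 x y) phi =
  pairing x (fun a => pairing y (fun b => phi (econcat a.1 b.1, econcat a.2 b.2))).
Proof.
rewrite /pairing big_allpairs_dep; apply: eq_bigr => p _.
by rewrite big_distrr; apply: eq_bigr => q _; rewrite /= mulrA.
Qed.

Lemma pairing_cop_id (x : seq ((endo * endo) * K)) phi :
  pairing (cop_id x) phi = pairing x (fun a => \sum_(q <- cop a.1) phi (q.1, q.2, a.2)).
Proof.
rewrite pairing_flatten_map; apply: eq_bigr => p _.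
by rewrite /pairing big_map big_distrr.
Qed.

Lemma pairing_id_cop (x : seq ((endo * endo) * K)) phi :
  pairing (id_cop x) phi = pairing x (fun a => \sum_(q <- cop a.2) phi (a.1, q.1, q.2)).
Proof.
rewrite pairing_flatten_map; apply: eq_bigr => p _.
by rewrite /pairing big_map big_distrr.
Qed.

Lemma pairing_counit_id (x : seq ((endo * endo) * K)) phi :
  pairing (counit_id x) phi = pairing x (fun a => (edeg a.1 == 0%N)%:R * phi a.2).
Proof.
by rewrite /pairing big_map; apply: eq_bigr => p _; rewrite /= mulrCA mulrA.
Qed.

Lemma pairing_id_counit (x : seq ((endo * endo) * K)) phi :
  pairing (id_counit x) phi = pairing x (fun a => (edeg a.2 == 0%N)%:R * phi a.1).
Proof.
by rewrite /pairing big_map; apply: eq_bigr => p _; rewrite /= mulrCA mulrA.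
Qed.

Lemma pairing_flip2 (x : seq ((endo * endo) * K)) phi :
  pairing (flip2 x) phi = pairing x (fun a => phi (a.2, a.1)).
Proof. by rewrite /pairing big_map. Qed.

Lemma counitE_pairing (s : seq (endo * K)) :
  counitE s = pairing s (fun f => (edeg f == 0%N)%:R).
Proof.
rewrite /counitE big_mkcond; apply: eq_bigr => p _.
by case: eqP; rewrite ?mulr1 ?mulr0.
Qed.

Lemma sum_indicator (T : Type) (r : seq T) (P : pred T) (F : T -> K) :
  \sum_(x <- r) (P x)%:R * F x = \sum_(x <- r | P x) F x.
Proof.
by rewrite [RHS]big_mkcond; apply: eq_bigr => x _; case: (P x); rewrite ?mul1r ?mul0r.
Qed.

(** * Antipode by recursion on the degree, for a general product and coproduct *)

Section Antipode.
Variables (cp : endo -> seq (endo * endo)) (m : endo -> endo -> endo).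

(** Solves S * id = unit ∘ counit for its leading term: the term with trivial second factor is S(f),
    and the other terms involve S only in smaller degree. The argument [n] is fuel bounding the
    degree. *)
Fixpoint antipode_rec n (f : endo) : seq (endo * K) :=
  if n is n'.+1 then
    if edeg f == 0%N then Defs.unitE K else
    flatten [seq [seq (m a.1 p.2, - a.2) | a <- antipode_rec n' p.1]
               | p <- cp f & edeg p.2 != 0%N]
  else Defs.unitE K.

Definition antipode f := antipode_rec (edeg f) f.

Hypothesis cp_edeg : forall f p, p \in cp f -> (edeg p.1 + edeg p.2)%N = edeg f.
Hypothesis cp_counit : forall (F : endo * endo -> K) f,
  \sum_(p <- cp f | edeg p.2 == 0%N) F p = F (f, eempty).
Hypothesis m_unit : right_id eempty m.

(** Every recursive call is on a first factor of strictly smaller degree, so fuel at least the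
    degree never runs out. *)
Lemma antipode_rec_fuel n f : (edeg f <= n)%N -> antipode_rec n f = antipode f.
Proof.
suff H k : forall n' f, (edeg f <= k)%N -> (edeg f <= n')%N ->
  antipode_rec k f = antipode_rec n' f by move=> fn; apply: H.
elim: k => [|k IH] [|n'] g //=; rewrite ?leqn0.
- by move=> /eqP->.
- by move=> _ /eqP->.
case: eqP => // _ gk gn; congr flatten; apply/eq_in_map => p.
rewrite mem_filter -lt0n => /andP[p2 /cp_edeg pg].
have lt : (edeg p.1 < edeg g)%N by rewrite -pg -[X in (X < _)%N]addn0 ltn_add2l.
by rewrite (IH n') // -ltnS (leq_trans lt).
Qed.

Lemma antipode_conv f phi :
  \sum_(p <- cp f) pairing (antipode p.1) (fun a => phi (m a p.2)) =
  (edeg f == 0%N)%:R * phi eempty.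
Proof.
(* The term with trivial second factor contributes [antipode f], which in positive degree cancels
   the rest by construction. *)
rewrite (bigID (fun p => edeg p.2 == 0%N)) /= cp_counit /=.
rewrite (eq_pairing _ (psi := phi)); last by move=> a; rewrite m_unit.
rewrite {1}/antipode; case f0: (edeg f) => [|n] /=.
  (* In degree 0 there are no other terms. *)
  rewrite pairing1 big_seq_cond big_pred0 ?addr0 // => p.
  apply/negP => /andP[/cp_edeg]; rewrite f0 => /eqP.
  by rewrite addn_eq0 => /andP[_ ->].
rewrite f0 /= mul0r /pairing big_flatten /= big_map big_filter -big_split big1_seq //=.
move=> p /andP[p2 /cp_edeg pf]; rewrite -/(antipode _) big_map.
rewrite antipode_rec_fuel; last first.
  rewrite -ltnS -f0 -pf -[X in (X < _)%N]addn0 ltn_add2l lt0n //.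
by rewrite -big_split big1 // => a _; rewrite /= mulNr addNr.
Qed.

End Antipode.

Definition swap (A B : Type) (p : A * B) := (p.2, p.1).

Definition antipodel := antipode cop econcat.
(** A right convolution inverse is a left one for the opposite product and coproduct. *)
Definition antipoder := antipode (fun f => map (@swap _ _) (cop f)) (fun a b => econcat b a).

Lemma antipodel_conv f phi :
  \sum_(p <- cop f) pairing (antipodel p.1) (fun a => phi (econcat a p.2)) =
  (edeg f == 0%N)%:R * phi eempty.
Proof.
apply: antipode_conv; [exact: cop_edeg | by move=> *; apply: cop_counitr | exact: econcate0].
Qed.

Lemma antipoder_conv f phi :
  \sum_(p <- cop f) pairing (antipoder p.2) (fun a => phi (econcat p.1 a)) =
  (edeg f == 0%N)%:R * phi eempty.
Proof.
have := @antipode_conv (fun f => map (@swap _ _) (cop f)) (fun a b => econcat b a) _ _ _ f phi.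
rewrite big_map; apply.
- by move=> g p /mapP[q /cop_edeg <- ->]; rewrite addnC.
- by move=> F g; rewrite big_map; apply: (cop_counitl (fun p => F (swap p))).
- exact: econcat0e.
Qed.

(* S = S * (id * S') = (S * id) * S' = S' in the convolution algebra *)
Lemma antipodelr f phi : pairing (antipodel f) phi = pairing (antipoder f) phi.
Proof.
(* The summand of the triple convolution S * id * S', evaluated at [phi]. *)
pose F a b c := pairing (antipodel a) (fun x =>
  pairing (antipoder c) (fun y => phi (econcat (econcat x b) y))).
transitivity (\sum_(p <- cop f) \sum_(q <- cop p.2) F p.1 q.1 q.2).
  (* With the inner sum over [cop p.2], id * S' collapses to the counit and S remains. *)
  under [RHS]eq_bigr => p _.
    rewrite -pairing_sum.
    under eq_pairing => x.
      under eq_bigr => q _ do under eq_pairing do rewrite -econcatA.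
      rewrite (antipoder_conv p.2 (fun z => phi (econcat x z))) econcate0; over.
    rewrite pairingZ; over.
  by rewrite sum_indicator (cop_counitr (fun p => pairing (antipodel p.1) phi)).
(* After regrouping, S * id collapses instead and S' remains. *)
rewrite -cop_coassoc.
under eq_bigr => p _.
  rewrite (eq_bigr _ (fun q _ => pairing_exchange _ _ _)) -pairing_sum.
  under eq_pairing => y.
    rewrite (antipodel_conv p.1 (fun z => phi (econcat z y))) econcat0e; over.
  rewrite pairingZ; over.
by rewrite sum_indicator (cop_counitl (fun p => pairing (antipoder p.2) phi)).
Qed.

(** A root with two leaves. With a single leaf, both factors of the only middle term of the
    coproduct would be the one-point map, hence no asymmetry. *)
Definition corolla3 : endo := Tagged (fun n => {ffun 'I_n -> 'I_n}) [ffun _ : 'I_3 => ord0].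

Lemma ideal_corolla3 (J : {set 'I_3}) :
  ideal (tagged corolla3) J = (ord0 \in J) ==> (J == setT).
Proof.
apply/idealP/implyP => [H J0|H x].
  by apply/eqP/setP => x; rewrite inE; apply: H; rewrite ffunE.
by rewrite ffunE => /H/eqP->; rewrite inE.
Qed.

(* The corolla has one ideal with one-element complement but two one-element ideals. *)
Lemma corolla3_not_cocommutative :
  ~ feq (copE [:: (corolla3, 1 : K)]) (flip2 (copE [:: (corolla3, 1)])).
Proof.
(* This test function counts the terms with first factor of degree 1, which after the flip are those
   with second factor of degree 1. *)
move=> /feq_pairing /(_ (fun p => (edeg p.1 == 1%N)%:R)).
rewrite pairing_flip2 !pairing_copE !pairing1 !mul1r !big_cop /=.
pose j1 : 'I_3 := Ordinal (isT : 1 < 3)%N; pose j2 : 'I_3 := Ordinal (isT : 2 < 3)%N.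
(* The set of the two leaves is the only ideal with a one-point complement. *)
rewrite (bigD1 [set~ ord0]) ?ideal_corolla3 ?inE //= setCK cards1 eqxx.
rewrite big1 => [|J /andP[]]; last first.
  rewrite ideal_corolla3 => idJ nJ; case: cards1P => // -[x Jx].
  case/negP: nJ; rewrite -(inj_eq (can_inj (@setCK _))) setCK Jx.
  case: (boolP (ord0 \in J)) idJ => [_ /= /eqP JT|J0 _].
    by have := set11 x; rewrite -Jx JT setCT inE.
  have : ord0 \in ~: J by rewrite inE.
  by rewrite Jx inE => /eqP->.
(* The one-point ideals are the two leaves. *)
rewrite (bigD1 [set j1]) ?ideal_corolla3 ?inE //= cards1 eqxx.
rewrite (bigD1 [set j2]) ?ideal_corolla3 ?inE ?(inj_eq set1_inj) //= cards1 eqxx.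
rewrite big1 => [|J /andP[/andP[]]]; last first.
  rewrite ideal_corolla3 => idJ nJ1 nJ2; case: cards1P => // -[x Jx].
  move: idJ nJ1 nJ2; rewrite Jx !(inj_eq set1_inj) inE.
  case: x Jx => [[|[|[|]]]] // ? _ /= /eqP E.
  by have := in_setT j1; rewrite -E inE.
(* The counts give 1 = 1 + 1, impossible in every characteristic. *)
by rewrite !addr0 -[LHS]addr0 => /addrI/esym/eqP; rewrite oner_eq0.
Qed.

(** * Verification of the Hopf axioms *)

Lemma EFSym_graded_hopf_holds : EFSym_graded_hopf K.
Proof.
split; [|split; [|split; [|split; [|split; [|split; [|split; [|split]]]]]]].
- move=> s t u; apply/feq_pairing => phi; rewrite !pairing_mulE.
  apply: eq_pairing => a; rewrite pairing_mulE; apply: eq_pairing => b.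
  by apply: eq_pairing => c; rewrite econcatA.
- move=> s; split; apply/feq_pairing => phi; rewrite pairing_mulE.
    by rewrite pairing1 mul1r; apply: eq_pairing => b; rewrite econcat0e.
  by apply: eq_pairing => a; rewrite pairing1 mul1r econcate0.
- move=> s; apply/feq_pairing => phi; rewrite pairing_cop_id pairing_id_cop !pairing_copE.
  apply: eq_pairing => f; exact: (cop_coassoc (fun a b c => phi (a, b, c))).
- move=> s; split; apply/feq_pairing => phi;
    rewrite (pairing_counit_id, pairing_id_counit) pairing_copE; apply: eq_pairing => f.
    by rewrite sum_indicator (cop_counitl (fun p => phi p.2)).
  by rewrite sum_indicator (cop_counitr (fun p => phi p.1)).
- split=> [s t|]; apply/feq_pairing => phi.
    rewrite pairing_mul2 !pairing_copE pairing_mulE; apply: eq_pairing => f.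
    under [RHS]eq_bigr do rewrite pairing_copE.
    rewrite -pairing_sum; apply: eq_pairing => g; exact: cop_econcat.
  by rewrite pairing_copE !pairing1 cop_eempty.
- split=> [s t|]; rewrite !counitE_pairing; last by rewrite pairing1 mulr1.
  rewrite pairing_mulE mulrC -pairingZ; apply: eq_pairing => a.
  rewrite mulrC -pairingZ; apply: eq_pairing => b.
  by rewrite /edeg /= addn_eq0 -natrM mulnb.
- by split=> // f p; apply: cop_edeg.
(* One map must be an inverse on both sides; in the second identity it is exchanged for
   [antipoder]. *)
- exists antipodel => s; split; apply/feq_pairing => phi.
    rewrite pairing_flatten_map pairing_scaleE pairing1 mul1r counitE_pairing.
    under eq_bigr => a _.
      rewrite pairing_mulE pairing_scaleE.
      under eq_pairing do rewrite pairing1 mul1r.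
      over.
    rewrite -/(pairing (copE s) (fun p => pairing (antipodel p.1) (fun a => phi (econcat a p.2)))).
    rewrite pairing_copE mulrC -pairingZ; apply: eq_pairing => f.
    by rewrite antipodel_conv mulrC.
  rewrite pairing_flatten_map pairing_scaleE pairing1 mul1r counitE_pairing.
  under eq_bigr => a _.
    rewrite pairing_mulE pairing1 antipodelr.
    over.
  rewrite -/(pairing (copE s) (fun p => pairing (antipoder p.2) (fun a => phi (econcat p.1 a)))).
  rewrite pairing_copE mulrC -pairingZ; apply: eq_pairing => f.
  by rewrite antipoder_conv mulrC.
- exists [:: (corolla3, 1)]; exact: corolla3_not_cocommutative.
Qed.

End Pairing.

(** * Compatible words *)

Lemma onth_map_enum (T : Type) n (x : 'I_n -> T) (i : 'I_n) :
  onth [seq x j | j <- enum 'I_n] i = Some (x i).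
Proof.
rewrite onthE -map_comp (nth_map i) ?size_enum_ord //=.
by rewrite nth_ord_enum.
Qed.

Lemma compatible_map_enum (T : eqType) (r : rel T) n (f : {ffun 'I_n -> 'I_n}) x :
  compatible r f [seq x j | j <- enum 'I_n] =
  [forall j, (f j != j) ==> r (x (f j)) (x j)].
Proof.
rewrite /compatible size_map size_enum_ord eqxx /=.
by apply: eq_forallb => j; rewrite !onth_map_enum.
Qed.

Lemma seq_map_enum (T : Type) (x0 : T) n (w : seq T) :
  size w = n -> w = [seq nth x0 w (j : 'I_n) | j <- enum 'I_n].
Proof.
move=> <-; rewrite -[LHS](mkseq_nth x0) /mkseq -val_enum_ord.
by rewrite -map_comp.
Qed.

(** * Generic words and triangularity *)

Definition letter0 : letter := exist _ (1, 2)%N isT.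

(** Positions start at 0 and indices of letters at 1, hence the successors. *)
Definition mk_letter (i j : nat) : letter := insubd letter0 (i.+1, j.+1).

Lemma val_mk_letter i j : i != j -> val (mk_letter i j) = (i.+1, j.+1).
Proof. by move=> ij; rewrite /mk_letter val_insubd /= eqSS ij. Qed.

(* The letter at [j] is a_{f(j),j}; a fixed point gets the fresh source [n]. *)
Definition generic_letter n (f : {ffun 'I_n -> 'I_n}) (j : 'I_n) : letter :=
  mk_letter (if f j == j then n else f j) j.

Definition generic_word (f : endo) : seq letter :=
  [seq generic_letter (tagged f) j | j <- enum 'I_(tag f)].

Lemma val_generic_letter n (f : {ffun 'I_n -> 'I_n}) j :
  val (generic_letter f j) = ((if f j == j then n else f j : nat).+1, (j : nat).+1).
Proof.
rewrite val_mk_letter //; case: (eqVneq (f j) j) => // _.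
by rewrite gtn_eqF.
Qed.

(** The letters at [g j] and [j] are related when the source at [j] is [g j]; the fresh source [n]
    matches no position. *)
Lemma compatible_generic_word n (f g : {ffun 'I_n -> 'I_n}) :
  compatible precA g (generic_word (Tagged _ f)) =
  [forall j, (g j != j) ==> (g j == f j)].
Proof.
rewrite /generic_word compatible_map_enum; apply: eq_forallb => j.
rewrite /precA !val_generic_letter /= eqSS; case: (eqVneq (g j) j) => //= gj.
case: (eqVneq (f j) j) => [->|//].
by rewrite ltn_eqF // (negPf gj).
Qed.

Definition moved (f : endo) := #|[set j | tagged f j != j]|.

(** Where [g] moves a point it agrees with [f], so its moved points are among those of [f]; equally
    many would force [g = f]. *)
Lemma compatible_moved (f g : endo) :
  compatible precA (tagged g) (generic_word f) -> g != f -> (moved g < moved f)%N.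
Proof.
case: f g => [n f] [m g] /= c; have nm : n = m.
  by case/andP: c => /eqP; rewrite size_map size_enum_ord.
case: m / nm g c => g; rewrite compatible_generic_word => /forallP gf.
apply: contraNltn; rewrite /moved /= => le.
have sub : [set j | g j != j] \subset [set j | f j != j].
  apply/subsetP => j; rewrite !inE => gj.
  by have := gf j; rewrite gj => /eqP <-.
have /eqP E : [set j | g j != j] == [set j | f j != j] by rewrite eqEcard sub.
apply/eqP; congr (Tagged _ _); apply/ffunP => j.
have := gf j; case: (eqVneq (g j) j) => [gj _|_ /eqP//].
have /setP/(_ j) := E; rewrite !inE gj eqxx => /esym/negbFE/eqP-> //.
Qed.

(** No condition of a concatenation links a letter of [u] to a letter of [v]. *)
Lemma compatible_econcat (T : eqType) (r : rel T) (f g : endo) (u v : seq T) :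
  size u = tag f ->
  compatible r (tagged (econcat f g)) (u ++ v) =
  compatible r (tagged f) u && compatible r (tagged g) v.
Proof.
move=> su; have onthl i : (i < tag f)%N -> onth (u ++ v) i = onth u i.
  by move=> fi; rewrite onth_cat su fi.
have onthr i : onth (u ++ v) (tag f + i) = onth v i.
  by rewrite onth_cat su ltnNge leq_addr /= addKn.
rewrite /compatible size_cat su eqn_add2l eqxx /= andbCA; congr andb.
apply/forallP/andP => [H|[/forallP Hf /forallP Hg] j].
  split; apply/forallP => j.
    have := H (lshift _ j); rewrite econcat_lshift /= !onthl //.
  have := H (rshift _ j); rewrite econcat_rshift /= !onthr.
  by rewrite -!val_eqE /= ?eqn_add2l.
rewrite -[j]splitK; case: (split j) => i /=.
  by rewrite econcat_lshift /= !onthl // -!val_eqE /=; apply: Hf.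
by rewrite econcat_rshift /= !onthr -!val_eqE /= ?eqn_add2l; apply: Hg.
Qed.

(** * Linear independence and products of the series *)

Section Series.
Variable K : fieldType.

Lemma Sf_linearly_independent (s : seq endo) (c : endo -> K) : uniq s ->
  (forall w : seq letter, \sum_(f <- s) c f * Sf K precA f w = 0) ->
  forall f, f \in s -> c f = 0.
Proof.
move=> us H f; have [k] := ubnP (moved f); elim: k f => // k IH f fk fs.
(* At this word only [f] and maps with fewer moved points have a nonzero coefficient, and the latter
   have [c g = 0] by induction. *)
have := H (generic_word f); rewrite (bigD1_seq f) //= big1_seq => [|g /andP[gf gs]].
  rewrite addr0 /Sf; case: f {fk fs} => n f; rewrite compatible_generic_word.
  by rewrite (introT forallP) ?mulr1 // => j; apply/implyP.
rewrite /Sf; case: (boolP (compatible _ _ _)) => [cg|_]; last by rewrite mulr0.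
by rewrite IH ?mul0r // (leq_trans (compatible_moved cg gf)).
Qed.

Lemma smul_Sf (T : eqType) (r : rel T) (f g : endo) (w : seq T) :
  smul (Sf K r f) (Sf K r g) w = Sf K r (econcat f g) w.
Proof.
rewrite /smul /Sf; have [fw|wf] := leqP (tag f) (size w); last first.
  rewrite big1 => [|i _].
    by rewrite /compatible ltn_eqF // ltn_addr.
  rewrite {1}/compatible ltn_eqF ?mul0r // size_take_min.
  exact: leq_ltn_trans (geq_minr _ _) wf.
(* Only the cut after [tag f] letters gives a prefix of the right length. *)
rewrite (bigD1 (Ordinal (fw : (tag f < (size w).+1)%N))) //= big1 => [|i ni].
  rewrite addr0 -natrM mulnb -compatible_econcat ?cat_take_drop //.
  by rewrite size_takel.
have ni' : (nat_of_ord i == tag f) = false by apply: contraNF ni => /eqP iE; apply/eqP/val_inj.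
by rewrite {1}/compatible size_takel ?ni' ?mul0r // -ltnS.
Qed.

Lemma Sf_eempty (T : eqType) (r : rel T) (w : seq T) : Sf K r eempty w = sone K w.
Proof.
rewrite /Sf /sone /compatible /= size_eq0; case: eqP => //= _.
by rewrite (introT forallP) // => -[].
Qed.

End Series.

(** * Words over the sum of two alphabets *)

Lemma mem_map_cons (X : eqType) (x : X) (s : seq (seq X)) (w : seq X) :
  (w \in map (cons x) s) = if w is y :: w' then (y == x) && (w' \in s) else false.
Proof.
case: w => [|y w]; first by apply/negP => /mapP[].
apply/mapP/andP => [[w' ws [-> ->]]|[/eqP-> ws]]; first by rewrite eqxx.
by exists w.
Qed.

Section Shuffles.
Variable T : eqType.
Implicit Types (u v : seq T) (w : seq (T + T)).

Definition getl (x : T + T) := if x is inl a then Some a else None.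
Definition getr (x : T + T) := if x is inr b then Some b else None.

Lemma shuffles_cons a u b v : shuffles (a :: u) (b :: v) =
  map (cons (inl a)) (shuffles u (b :: v)) ++ map (cons (inr b)) (shuffles (a :: u) v).
Proof. by []. Qed.

Lemma shuffles0 u : shuffles u [::] = [:: map inl u].
Proof. by case: u. Qed.

(** Induction on [w]: its first letter shows from which of the two words it was taken. *)
Lemma mem_shuffles u v w :
  (w \in shuffles u v) = (pmap getl w == u) && (pmap getr w == v).
Proof.
elim: w u v => [|x w IH] u v.
  case: u v => [|a u] [|b v] //=; try by rewrite inE.
  by rewrite -/(shuffles (a :: u) (b :: v)) shuffles_cons mem_cat !mem_map_cons.
case: u => [|a u].
  case: v => [|b v]; first by rewrite inE; case: x => c; rewrite /= ?andbF.
  by case: x => [c|c]; rewrite inE //= !eqseq_cons andbCA -IH mem_seq1.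
case: v => [|b v].
  rewrite shuffles0 inE; case: x => [c|c] //=; last by rewrite andbF.
  by rewrite !eqseq_cons -andbA -IH shuffles0 mem_seq1.
rewrite shuffles_cons mem_cat !mem_map_cons !IH.
case: x => c; rewrite /= !eqseq_cons.
  by rewrite orbF andbA.
by rewrite andbCA.
Qed.

(** The first letter separates the two halves of the list. Hence a sum over shuffles counts each
    word once. *)
Lemma uniq_shuffles u v : uniq (shuffles u v).
Proof.
have consI (x : T + T) : injective (cons x) by move=> w w' [].
elim: u v => [//|a u IHu]; elim=> [//|b v IHv].
rewrite shuffles_cons cat_uniq !map_inj_uniq // IHu IHv andbT.
by apply/hasPn => _ /mapP[w _ ->] /=; rewrite mem_map_cons.
Qed.

End Shuffles.

Section Restriction.
Variables (T : eqType) (r : rel T) (n : nat).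
Implicit Types (f : {ffun 'I_n -> 'I_n}) (A : {set 'I_n}).

Lemma map_enum_set (S : Type) (x : 'I_n -> S) A :
  [seq x j | j <- enum A] = [seq x (enum_val i) | i <- enum 'I_#|A|].
Proof.
rewrite (@enum_ord_mono _ _ (@enum_val _ (pred_of_set A)) A).
- by rewrite -map_comp.
- exact: enum_val_homo.
- exact: codom_enum_val.
Qed.

(** Brings compatibility of a subword back to the original positions; points fixed by the
    restriction impose nothing. *)
Lemma compatible_estd f A (x : 'I_n -> T) :
  compatible r (tagged (estd f A)) [seq x j | j <- enum A] =
  [forall j, [&& j \in A, f j \in A & f j != j] ==> r (x (f j)) (x j)].
Proof.
rewrite map_enum_set compatible_map_enum.
apply/forallP/forallP => H j; apply/implyP.
  case/and3P => + fA fj; rewrite codom_enum_val => /codomP[i ij].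
  have := H i; rewrite -(inj_eq enum_val_inj) -estd_enum_val /rfun -ij fA fj; exact.
rewrite -(inj_eq enum_val_inj) -estd_enum_val /rfun.
case: ifP => fA fj; last by rewrite eqxx in fj.
by have := H (enum_val j); rewrite fA fj enum_valP; apply.
Qed.

End Restriction.

Definition is_inr (A B : Type) (x : A + B) := if x is inr _ then true else false.

Definition posr (S T : Type) n (w : seq (S + T)) : {set 'I_n} :=
  [set i : 'I_n | oapp (@is_inr S T) false (onth w i)].

Definition outl (T : Type) (d : T) (x : T + T) := if x is inl a then a else d.
Definition outr (T : Type) (d : T) (x : T + T) := if x is inr b then b else d.

Lemma map_nth_index (S T : eqType) (d : T) (s : seq S) (v : seq T) :
  uniq s -> size v = size s -> [seq nth d v (index j s) | j <- s] = v.
Proof.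
move=> us sv; apply: (@eq_from_nth _ d); rewrite size_map // => i si.
have [y _] : exists y : S, true by case: s si {us sv} => // y *; exists y.
by rewrite (nth_map y) // index_uniq.
Qed.

Section WordsOverSum.
Variables (T : eqType) (d : T) (n : nat).
Implicit Types x : 'I_n -> T + T.

Lemma posr_map_enum x i : (i \in posr n [seq x j | j <- enum 'I_n]) = is_inr (x i).
Proof. by rewrite inE onth_map_enum. Qed.

Lemma pmap_getl x : let w := [seq x j | j <- enum 'I_n] in
  pmap (@getl T) w = [seq outl d (x j) | j <- enum (~: posr n w)].
Proof.
move=> w; rewrite enum_set_filter.
rewrite (eq_filter (a2 := fun i => ~~ is_inr (x i))); last first.
  by move=> i; rewrite in_setC posr_map_enum.
by rewrite {}/w; elim: (enum _) => //= i s ->; case E: (x i) => [a|a]; rewrite /= ?E.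
Qed.

Lemma pmap_getr x : let w := [seq x j | j <- enum 'I_n] in
  pmap (@getr T) w = [seq outr d (x j) | j <- enum (posr n w)].
Proof.
move=> w; rewrite enum_set_filter.
rewrite (eq_filter (a2 := fun i => is_inr (x i))); last first.
  by move=> i; rewrite posr_map_enum.
by rewrite {}/w; elim: (enum _) => //= i s ->; case E: (x i) => [a|a]; rewrite /= ?E.
Qed.

(** At each position [posr] decides the alphabet, and the corresponding subword gives the letter. *)
Lemma posr_inj (w w' : seq (T + T)) : size w = n -> size w' = n ->
  pmap (@getl T) w = pmap (@getl T) w' -> pmap (@getr T) w = pmap (@getr T) w' ->
  posr n w = posr n w' -> w = w'.
Proof.
move=> /(seq_map_enum (inl d)) -> /(seq_map_enum (inl d)) ->.
move: (fun j : 'I_n => _) (fun j : 'I_n => _) => x y.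
rewrite !pmap_getl !pmap_getr => El Er pE; move: El Er; rewrite pE.
move=> /eq_in_map El /eq_in_map Er; apply/eq_map => j.
have := posr_map_enum y j; rewrite pE posr_map_enum.
have := Er j; have := El j; rewrite !mem_enum in_setC posr_map_enum.
by case: (x j) (y j) => a [b|b] //= => [/(_ isT)-> | _ /(_ isT)->].
Qed.

Lemma posr_surj (u v : seq T) (I : {set 'I_n}) : size u = #|~: I| -> size v = #|I| ->
  exists w, [/\ size w = n, pmap (@getl T) w = u, pmap (@getr T) w = v & posr n w = I].
Proof.
rewrite !cardE => su sv.
(* The letter at [j] is read from [v] or [u] at the rank of [j] in [I] or in its complement. *)
pose x j : T + T := if j \in I then inr (nth d v (index j (enum I)))
                   else inl (nth d u (index j (enum (~: I)))).
have pI : posr n [seq x j | j <- enum 'I_n] = I.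
  by apply/setP => j; rewrite posr_map_enum /x; case: (j \in I).
exists [seq x j | j <- enum 'I_n]; split=> //; first by rewrite size_map size_enum_ord.
  rewrite pmap_getl pI -[RHS](map_nth_index d (enum_uniq _) su).
  by apply/eq_in_map => j; rewrite mem_enum in_setC /x => /negPf->.
rewrite pmap_getr pI -[RHS](map_nth_index d (enum_uniq _) sv).
by apply/eq_in_map => j; rewrite mem_enum /x => ->.
Qed.

End WordsOverSum.

(** For a moved point [j], consider the alphabets of the letters at [f j] and [j]: equal ones give
    the two restricted conditions, A then B is always allowed, and B then A is what the ideal
    condition excludes. *)
Lemma compatible_precAB n (f : {ffun 'I_n -> 'I_n}) (w : seq (letter + letter)) :
  size w = n ->
  compatible precAB f w =
  [&& ideal f (posr n w),
      compatible precA (tagged (estd f (~: posr n w))) (pmap (@getl letter) w)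
    & compatible precA (tagged (estd f (posr n w))) (pmap (@getr letter) w)].
Proof.
move=> /(seq_map_enum (inl letter0)) ->; move: (fun j : 'I_n => _) => x.
rewrite compatible_map_enum (pmap_getl letter0) (pmap_getr letter0) !compatible_estd.
apply/forallP/and3P => [H|[/idealP Hi /forallP Hl /forallP Hr] j].
  split; [apply/idealP => j | apply/forallP => j | apply/forallP => j].
  - have := H j; rewrite !posr_map_enum; case: eqP => [->//|_] /=.
    by case: (x (f j)) (x j) => a [b|b].
  - have := H j; rewrite !in_setC !posr_map_enum; case: eqP => _; first by rewrite !andbF.
    by case: (x (f j)) (x j) => a [b|b].
  - have := H j; rewrite !posr_map_enum; case: eqP => _; first by rewrite !andbF.
    by case: (x (f j)) (x j) => a [b|b].
have := Hi j; have := Hl j; have := Hr j; rewrite !in_setC !posr_map_enum.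
case: eqP => //= _; case: (x (f j)) (x j) => a [b|b] //= _ _; exact.
Qed.

Lemma Sf_precAB (K : fieldType) (f : endo) (u v : seq letter) :
  \sum_(w <- shuffles u v) Sf K precAB f w =
  \sum_(I : {set 'I_(tag f)} | ideal (tagged f) I)
    Sf K precA (estd (tagged f) (~: I)) u * Sf K precA (estd (tagged f) I) v.
Proof.
case: f => n f /=.
pose P I := [&& ideal f I, compatible precA (tagged (estd f (~: I))) u
               & compatible precA (tagged (estd f I)) v].
(* Both sides become sums of ones: over the ideals with both factors compatible, and over the
   compatible shuffles. *)
transitivity (\sum_(I | P I) (1 : K)); last first.
  rewrite [RHS]big_mkcond [LHS]big_mkcond; apply: eq_bigr => I _.
  by rewrite /P /Sf -natrM mulnb; case: (ideal f I) => //=; case: (_ && _).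
transitivity (\sum_(w <- [seq w <- shuffles u v | compatible precAB f w]) (1 : K)).
  by rewrite big_filter [RHS]big_mkcond; apply: eq_bigr => w _; rewrite /Sf; case: compatible.
have memW w : (w \in [seq w <- shuffles u v | compatible precAB f w]) =
    [&& compatible precAB f w, pmap (@getl _) w == u & pmap (@getr _) w == v].
  by rewrite mem_filter mem_shuffles.
have sizeW w : compatible precAB f w -> size w = n by case/andP => /eqP.
(* The map [posr n] is a bijection between these two index sets. *)
rewrite -(big_map (posr n) predT (fun _ => 1)) big_uniq /=.
  apply: eq_bigl => I; apply/mapP/and3P => [[w + ->]|[idI cu cv]].
    rewrite memW => /and3P[cw /eqP<- /eqP<-]; move: cw (sizeW _ cw) => + sw.
    by rewrite compatible_precAB // => /and3P.
  have [su _] := andP cu; have [sv _] := andP cv.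
  have [w [sw wu wv wI]] := posr_surj letter0 (eqP su) (eqP sv).
  exists w => //; rewrite memW wu wv !eqxx compatible_precAB // wI wu wv.
  by rewrite idI cu cv.
rewrite map_inj_in_uniq ?filter_uniq ?uniq_shuffles // => w w'.
rewrite !memW => /and3P[/sizeW sw /eqP wu /eqP wv] /and3P[/sizeW sw' /eqP wu' /eqP wv'].
by apply: (posr_inj letter0) => //; rewrite ?wu ?wv.
Qed.

Theorem mainTheorem12 (K : fieldType) :
  (* (i) linear independence of the S^f *)
  (forall (s : seq endo) (c : endo -> K), uniq s ->
     (forall w : seq letter, \sum_(f <- s) c f * Sf K precA f w = 0) ->
     forall f, f \in s -> c f = 0)
  /\
  (* (ii) S^f S^g = S^{f.g}, and S^{empty} = 1 *)
  ((forall (f g : endo) (w : seq letter),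
      smul (Sf K precA f) (Sf K precA g) w = Sf K precA (econcat f g) w)
   /\ (forall w : seq letter, Sf K precA eempty w = sone K w))
  /\
  (* (iii) S^f(A (+) B), letters of A commuting with letters of B *)
  (forall (f : endo) (u v : seq letter),
     \sum_(w <- shuffles u v) Sf K precAB f w =
     \sum_(I : {set 'I_(tag f)} | ideal (tagged f) I)
        Sf K precA (estd (tagged f) (~: I)) u * Sf K precA (estd (tagged f) I) v)
  /\
  (* (iv) graded non-cocommutative Hopf algebra *)
  EFSym_graded_hopf K.
Proof.
split; first exact: Sf_linearly_independent.
split; first by split=> *; [apply: smul_Sf | apply: Sf_eempty].
split; first exact: Sf_precAB.
exact: EFSym_graded_hopf_holds.
Qed.
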